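(* Let $p\in\mathbb N$ ($p\ge1$) and let $m$ be an integer with $0\le m\le p$. For $n\ge0$ let $\zeta_n^*(r)=C_nr^{\tau_n}$, where $C_n\ge0$, $\{\tau_n\}_{n\ge1}$ is a strictly increasing sequence of natural numbers and $\zeta_0^*(r)=1$ (so $C_0=1$, $\tau_0=0$). Assume that $\zeta^*=\{\zeta_n^*(r)\}_{n=0}^\infty\in\mathcal F$ and that it is a decreasing sequence of functions, i.e. $\zeta_{n+1}^*(r)\le\zeta_n^*(r)$ for all $n\ge0$ and $r\in[0,1)$. Let $d_n=\tau_m+p\tau_n$ be the degree of the monomial $\zeta_m^*(r)\zeta_n^*(r^p)$. Let $f\in\mathcal B$ with $f(z)=z^m\sum_{n=0}^\infty a_{np+m}z^{np}$, and put $$B^*_{f_m}(r)=\sum_{n=1}^{\infty}(-1)^{d_n}|a_{np+m}|\,\zeta_n^*(r^p).$$ (I) Suppose that either $d_{2n}$ is even and $d_{2n-1}$ is odd for all $n\ge1$, or $d_{2n}$ is odd and $d_{2n-1}$ is even for all $n\ge1$. Let $\sigma$ denote the common value of $(-1)^{d_{2n-1}}$, $n\ge 1$, and $$C^*_{f_m}(r)=\zeta_m^*(r)\Big[B^*_{f_m}(r)+\sigma\sum_{n=0}^{\infty}|a_{np+m}|^2\sum_{k=n}^{\infty}\zeta^*_{2k+1}(r^p)\Big].$$ Then $$|C^*_{f_m}(r)|\le1\quad\text{for } r\le r_*,$$ where $r_*\in(0,1)$ is the root of the equation $\zeta_m^*(r)\sum_{n=1}^\infty\zeta^*_{2n-1}(r^p)=1$.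 The inequality is sharp: equality holds at $r=r_*$ for $f(z)=z^{p+m}$. (II) Suppose that $d_{2n}$ and $d_{2n-1}$ are even for all $n\ge1$, or that $d_{2n}$ and $d_{2n-1}$ are odd for all $n\ge1$. Let $\sigma$ denote the common value of $(-1)^{d_n}$, $n\ge1$, and $$D^*_{f_m}(r)=\zeta_m^*(r)\Big[B^*_{f_m}(r)+\sigma\sum_{n=1}^{\infty}|a_{np+m}|^2\Big(\frac{\zeta^*_{2n}(r^p)}{1+|a_m|}+\sum_{k=2n+1}^{\infty}\zeta^*_k(r^p)\Big)\Big].$$ Then $$|D^*_{f_m}(r)|\le1\quad\text{for } r\le R_*,$$ where $R_*\in(0,1)$ is the root of the equation $\zeta_m^*(r)\sum_{n=1}^\infty\zeta^*_n(r^p)=1$. The inequality is sharp: equality holds at $r=R_*$ for $f(z)=z^{p+m}$.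
   Context: $\mathbb D=\{z\in\mathbb C:|z|<1\}$. $\mathcal B$ is the class of analytic functions $f$ on $\mathbb D$ with $|f(z)|<1$ for all $z\in\mathbb D$. $\mathcal F$ is the set of all sequences $\{\zeta_n(r)\}_{n=0}^\infty$ of nonnegative continuous functions on $[0,1)$ such that $\sum_{n=0}^\infty\zeta_n(r)$ converges locally uniformly with respect to $r\in[0,1)$. It is assumed that the roots $r_*$, $R_*$ exist in the respective cases. *)

(* Defs.v *)
From Stdlib Require Export Reals.
From Coquelicot Require Export Coquelicot.
Local Open Scope R_scope.

Definition unit_disc (z : C) : Prop := Cmod z < 1.

(* Analyticity is complex differentiability: the derivative is taken over the
   field [C], so this is not real differentiability in the plane. *)
Definition class_B (f : C -> C) : Prop :=
  (forall z : C, unit_disc z ->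
     ex_derive (K := C_AbsRing) (V := C_NormedModule) f z) /\
  (forall z : C, unit_disc z -> Cmod (f z) < 1).

(* The local uniformity is relative to [0,1): each point r0 has a relative
   neighbourhood in [0,1) on which the partial sums converge uniformly.
   [CVU_dom] compares with the total [Lim_seq]; it nevertheless forces the
   pointwise convergence of the partial sums. *)
Definition class_F (zeta : nat -> R -> R) : Prop :=
  (forall n r, 0 <= r < 1 -> 0 <= zeta n r) /\
  (forall n, continuous_on (fun r => 0 <= r < 1) (zeta n)) /\
  (forall r0, 0 <= r0 < 1 -> exists delta : posreal,
     CVU_dom (fun N r => sum_n (fun n => zeta n r) N)
             (fun r => 0 <= r < 1 /\ Rabs (r - r0) < delta)).

Definition monomial_seq (c : nat -> R) (tau : nat -> nat) (n : nat) (r : R) : R :=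
  c n * r ^ tau n.

Definition monomial_deg (tau : nat -> nat) (p m n : nat) : nat :=
  (tau m + p * tau n)%nat.

(* f(z) = z^m * sum_{n >= 0} a_{np+m} z^{np} on the unit disc; [a] is indexed by
   the exponent of z, and only its values at the indices np+m are ever used. *)
Definition lacunary_expansion (p m : nat) (f : C -> C) (a : nat -> C) : Prop :=
  forall z : C, unit_disc z -> exists s : C,
    is_series (K := C_AbsRing) (V := C_NormedModule)
      (fun n => (a (n * p + m)%nat * z ^ (n * p))%C) s /\
    f z = (z ^ m * s)%C.

(* sum_{n >= k} u n *)
Definition Series_from (k : nat) (u : nat -> R) : R :=
  Series (fun j => u (k + j)%nat).

Section Sums.
Variables (c : nat -> R) (tau : nat -> nat) (p m : nat) (a : nat -> C).

Let zeta := monomial_seq c tau.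
Let abs_coef (n : nat) : R := Cmod (a (n * p + m)%nat).

Definition B_star (r : R) : R :=
  Series_from 1 (fun n =>
    (-1) ^ monomial_deg tau p m n * abs_coef n * zeta n (r ^ p)).

Definition C_star (sigma r : R) : R :=
  zeta m r *
    (B_star r +
     sigma * Series_from 0 (fun n =>
       abs_coef n ^ 2 *
       Series_from n (fun k => zeta (2 * k + 1)%nat (r ^ p)))).

Definition D_star (sigma r : R) : R :=
  zeta m r *
    (B_star r +
     sigma * Series_from 1 (fun n =>
       abs_coef n ^ 2 *
       (zeta (2 * n)%nat (r ^ p) / (1 + Cmod (a m)) +
        Series_from (2 * n + 1) (fun k => zeta k (r ^ p))))).

End Sums.

(* Main.v *)
Require Import Defs.
From Stdlib Require Import Arith Lra Lia.
Local Open Scope R_scope.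

(** With [b n = a (n * p + m)] and [Z n] the value of the n-th monomial at r^p, the
    theorem reduces to the sharp coefficient inequalities
      |b_(2k+1)| + sum_(n<=k) |b_n|^2 <= 1,
      |b_(2k+2)| + sum_(n<=k) |b_n|^2 + |b_(k+1)|^2 / (1 + |b_0|) <= 1.
    For a bounded g(w) = sum b_n w^n and a polynomial V, the N-th coefficient of g V^2 is
    at most the squared l^2 norm of V.  Take V(w) = 1 + sum_(i<=k) u_i w^(N-i) with
    2k <= N: that coefficient is b_N + 2 sum u_i b_i, plus u_k^2 b_0 if N = 2k, and the
    choice u_i = conj b_i (with u_k optimised separately when N = 2k) gives both
    inequalities.  The means over the circle are means over roots of unity, applied to a
    partial sum of g on a circle of radius < 1, and the radius tends to 1.

    Summation by parts turns sigma C* / zeta_m into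
      sum_k (Z_(2k+1) (|b_(2k+1)| + sum_(n<=k) |b_n|^2) - |b_(2k+2)| Z_(2k+2)),
    whose k-th term lies between -Z_(2k+1) and Z_(2k+1); D* is treated in the same way. *)

(** * Finite sums in C, with the additive monoid fixed *)

Definition Csum (u : nat -> C) (n : nat) : C :=
  sum_n (G := C_AbelianMonoid) u n.

Lemma Csum_O u : Csum u 0 = u 0%nat.
Proof. exact (sum_O u). Qed.

Lemma Csum_S u n : Csum u (S n) = (Csum u n + u (S n))%C.
Proof. exact (sum_Sn u n). Qed.

Lemma Csum_ext u v n :
  (forall i, (i <= n)%nat -> u i = v i) -> Csum u n = Csum v n.
Proof. exact (sum_n_ext_loc (G := C_AbelianMonoid) u v n). Qed.

Lemma Csum_plus u v n : Csum (fun i => u i + v i)%C n = (Csum u n + Csum v n)%C.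
Proof. exact (sum_n_plus (G := C_AbelianMonoid) u v n). Qed.

Lemma Csum_mult_l x u n : Csum (fun i => x * u i)%C n = (x * Csum u n)%C.
Proof. exact (sum_n_mult_l (K := C_Ring) x u n). Qed.

Lemma Csum_switch (u : nat -> nat -> C) m n :
  Csum (fun i => Csum (u i) n) m = Csum (fun j => Csum (fun i => u i j) m) n.
Proof. exact (sum_n_switch (G := C_AbelianMonoid) u m n). Qed.

Lemma Csum_zero (u : nat -> C) n :
  (forall i, (i <= n)%nat -> u i = RtoC 0) -> Csum u n = RtoC 0.
Proof.
  intros H; induction n as [|n IH].
  - rewrite Csum_O; apply H; lia.
  - rewrite Csum_S, IH, H by (intros; try apply H; lia). ring.
Qed.

Lemma Csum_single (u : nat -> C) n j :
  (j <= n)%nat -> (forall i, (i <= n)%nat -> i <> j -> u i = RtoC 0) -> Csum u n = u j.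
Proof.
  induction n as [|n IH]; intros Hj H.
  - rewrite Csum_O. now replace j with 0%nat by lia.
  - rewrite Csum_S. destruct (Nat.eq_dec j (S n)) as [->|Hne].
    + rewrite Csum_zero by (intros; apply H; lia). ring.
    + rewrite IH, (H (S n)) by (intros; try apply H; lia). ring.
Qed.

Lemma Cconj_Csum u n : Cconj (Csum u n) = Csum (fun i => Cconj (u i)) n.
Proof.
  induction n as [|n IH]; [now rewrite !Csum_O|].
  now rewrite !Csum_S, Cplus_conj, IH.
Qed.

Lemma RtoC_sum_n (u : nat -> R) n : RtoC (sum_n u n) = Csum (fun i => RtoC (u i)) n.
Proof.
  induction n as [|n IH]; [now rewrite Csum_O, sum_O|].
  rewrite Csum_S, sum_Sn, <- IH. exact (RtoC_plus _ _).
Qed.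

Lemma Re_Csum u n : Re (Csum u n) = sum_n (fun i => Re (u i)) n.
Proof.
  induction n as [|n IH]; [now rewrite Csum_O, sum_O|].
  rewrite Csum_S, sum_Sn, <- IH. reflexivity.
Qed.

Lemma Cmod_Csum u n : Cmod (Csum u n) <= sum_n (fun i => Cmod (u i)) n.
Proof.
  induction n as [|n IH]; [rewrite Csum_O, sum_O; lra|].
  rewrite Csum_S, sum_Sn. eapply Rle_trans; [apply Cmod_triangle|].
  apply Rplus_le_compat_r, IH.
Qed.

Lemma sum_n_le_loc (u v : nat -> R) n :
  (forall i, (i <= n)%nat -> u i <= v i) -> sum_n u n <= sum_n v n.
Proof.
  intros H; induction n as [|n IH]; [rewrite !sum_O; apply H; lia|].
  rewrite !sum_Sn. apply Rplus_le_compat; [apply IH; intros; apply H; lia|apply H; lia].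
Qed.

Lemma sum_n_nonneg (u : nat -> R) n : (forall i, 0 <= u i) -> 0 <= sum_n u n.
Proof.
  intros H. rewrite <- (Rmult_0_r (INR (S n))), <- sum_n_const.
  apply sum_n_le_loc. intros; apply H.
Qed.

(** * Means over roots of unity *)

Definition cis (x : R) : C := (cos x, sin x).

Lemma cis_add x y : cis (x + y) = (cis x * cis y)%C.
Proof. unfold cis, Cmult; simpl. rewrite cos_plus, sin_plus. f_equal; ring. Qed.

Lemma cis_pow x n : (cis x ^ n)%C = cis (INR n * x).
Proof.
  induction n as [|n IH].
  - simpl. unfold cis. now rewrite Rmult_0_l, cos_0, sin_0.
  - rewrite Cpow_S, IH, <- cis_add, S_INR. f_equal; ring.
Qed.

Lemma Cmod_cis x : Cmod (cis x) = 1.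
Proof.
  unfold Cmod, cis; simpl. rewrite !Rmult_1_r, Rplus_comm.
  change (sqrt (Rsqr (sin x) + Rsqr (cos x)) = 1).
  rewrite sin2_cos2. apply sqrt_1.
Qed.

(** The real part is cos x = 1 - 2 sin^2(x/2), and sin is positive at x/2, which lies strictly
    between 0 and pi. *)
Lemma cis_neq_1 x : 0 < x < 2 * PI -> cis x <> 1.
Proof.
  intros [H0 H1] H. injection H as Hc _.
  replace x with (2 * (x / 2)) in Hc by field.
  rewrite cos_2a_sin in Hc.
  assert (0 < sin (x / 2)) by (apply sin_gt_0; lra). nra.
Qed.

Section RootMean.
(* [sum_n] includes its last index, so that [K'] is one less than the number of roots. *)
Variable K' : nat.
Let K := S K'.
Let om := cis (2 * PI / INR K).

(** A finite substitute for the integral over the unit circle, exact on polynomials of degree below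
    [K]. *)
Definition root_mean (h : C -> C) : C :=
  (/ INR (S K') * Csum (fun j => h (cis (2 * PI / INR (S K')) ^ j)%C) K')%C.

Lemma INR_K_pos : 0 < INR K.
Proof. apply lt_0_INR; unfold K; lia. Qed.

Lemma om_K : (om ^ K)%C = 1.
Proof.
  unfold om. rewrite cis_pow.
  replace (INR K * (2 * PI / INR K)) with (2 * PI)
    by (field; apply Rgt_not_eq, INR_K_pos).
  unfold cis. now rewrite cos_2PI, sin_2PI.
Qed.

Lemma om_neq_1 n : (0 < n < K)%nat -> (om ^ n)%C <> 1.
Proof.
  intros [H0 H1]. unfold om. rewrite cis_pow. apply cis_neq_1.
  pose proof INR_K_pos. apply lt_INR in H0, H1. simpl in H0.
  pose proof PI_RGT_0.
  assert (0 < INR n / INR K < 1).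
  { split; [apply Rdiv_lt_0_compat; lra|].
    apply (Rmult_lt_reg_r (INR K)); [lra|]. field_simplify; lra. }
  replace (INR n * (2 * PI / INR K)) with (2 * PI * (INR n / INR K)) by (field; lra).
  split; nra.
Qed.

Lemma root_mean_ext g h : (forall j, g (om ^ j)%C = h (om ^ j)%C) ->
  root_mean g = root_mean h.
Proof. intros H. unfold root_mean. f_equal. apply Csum_ext. intros; apply H. Qed.

Lemma root_mean_plus g h :
  root_mean (fun w => g w + h w)%C = (root_mean g + root_mean h)%C.
Proof. unfold root_mean. rewrite Csum_plus. ring. Qed.

Lemma root_mean_scal x h : root_mean (fun w => x * h w)%C = (x * root_mean h)%C.
Proof. unfold root_mean. rewrite Csum_mult_l. ring. Qed.

Lemma root_mean_Csum (h : nat -> C -> C) n :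
  root_mean (fun w => Csum (fun i => h i w) n) = Csum (fun i => root_mean (h i)) n.
Proof. unfold root_mean. rewrite Csum_switch, Csum_mult_l. reflexivity. Qed.

(** Multiplication by q - 1 telescopes the sum to q^(n+1) - 1 = 0. *)
Lemma Csum_geom (q : C) n : q <> 1 -> (q ^ S n)%C = 1 -> Csum (fun j => q ^ j)%C n = 0.
Proof.
  intros Hq H.
  assert (E : ((q - 1) * Csum (fun j => q ^ j)%C n = q ^ S n - 1)%C).
  { clear. induction n as [|n IH].
    - rewrite Csum_O. simpl. ring.
    - rewrite Csum_S, Cmult_plus_distr_l, IH, !Cpow_S. ring. }
  rewrite H in E.
  assert (Hq' : (q - 1)%C <> 0).
  { intros F. apply Hq. replace q with ((q - 1) + 1)%C by ring. rewrite F. ring. }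
  replace (Csum (fun j => q ^ j)%C n)
    with (/ (q - 1) * ((q - 1) * Csum (fun j => q ^ j)%C n))%C by (field; exact Hq').
  rewrite E. ring.
Qed.

Lemma root_mean_one : root_mean (fun _ => 1) = 1.
Proof.
  unfold root_mean. rewrite <- (RtoC_sum_n (fun _ => 1)), sum_n_const, Rmult_1_r.
  pose proof INR_K_pos. unfold K in H.
  rewrite <- RtoC_inv by lra. rewrite <- RtoC_mult. f_equal. field. lra.
Qed.

Lemma root_mean_pow_0 n : (0 < n < K)%nat -> root_mean (fun w => w ^ n)%C = 0.
Proof.
  intros H. unfold root_mean.
  rewrite (Csum_ext _ (fun j => (om ^ n) ^ j)%C).
  - rewrite Csum_geom; [ring|now apply om_neq_1|].
    change (S K') with K. now rewrite <- Cpow_mult_r, Nat.mul_comm, Cpow_mult_r, om_K, Cpow_1_l.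
  - intros j _. fold K om. now rewrite <- !Cpow_mult_r, Nat.mul_comm.
Qed.

Lemma om_pow_K j : ((om ^ j) ^ K)%C = 1.
Proof. now rewrite <- Cpow_mult_r, Nat.mul_comm, Cpow_mult_r, om_K, Cpow_1_l. Qed.

(** Exponents above [K] reduce by w^K = 1. The range reaches beyond [K] because negative powers
    w^(-e) are written w^(K-e) below. *)
Lemma root_mean_pow n : (n < 2 * K)%nat ->
  root_mean (fun w => w ^ n)%C =
  if Nat.eq_dec n 0 then 1 else if Nat.eq_dec n K then 1 else 0.
Proof.
  intros H. destruct (Nat.eq_dec n 0) as [->|H0]; [apply root_mean_one|].
  destruct (Nat.eq_dec n K) as [->|H1].
  - rewrite (root_mean_ext _ (fun _ => RtoC 1)); [apply root_mean_one|apply om_pow_K].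
  - destruct (lt_dec n K) as [H2|H2]; [apply root_mean_pow_0; lia|].
    rewrite (root_mean_ext _ (fun w => w ^ (n - K))%C); [apply root_mean_pow_0; lia|].
    intros j. replace n with (K + (n - K))%nat at 1 by lia.
    rewrite Cpow_add_r, om_pow_K. ring.
Qed.

Lemma Cmod_root_mean_le g (h : C -> R) :
  (forall j, Cmod (g (om ^ j)%C) <= h (om ^ j)%C) ->
  Cmod (root_mean g) <= Re (root_mean (fun w => h w)).
Proof.
  intros H. pose proof INR_K_pos. unfold K in H0.
  assert (0 < / INR (S K')) by now apply Rinv_0_lt_compat.
  unfold root_mean. rewrite <- RtoC_inv by lra. rewrite Cmod_mult, Cmod_R, Rabs_pos_eq by lra.
  rewrite <- (RtoC_sum_n (fun j => h (om ^ j)%C)), <- RtoC_mult.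
  unfold Re, RtoC; cbn [fst]. apply Rmult_le_compat_l; [lra|].
  eapply Rle_trans; [apply Cmod_Csum|]. apply sum_n_le_loc. intros; apply H.
Qed.

(** Conjugation inverts a root of unity, and w^(-n) = w^(K-n) keeps the exponent a natural
    number. *)
Lemma Cconj_om_pow j n : (n <= K)%nat -> Cconj ((om ^ j) ^ n)%C = ((om ^ j) ^ (K - n))%C.
Proof.
  intros H. set (w := (om ^ j)%C).
  assert (E : (w ^ n * w ^ (K - n))%C = 1).
  { rewrite <- Cpow_add_r. replace (n + (K - n))%nat with K by lia. apply om_pow_K. }
  assert (E2 : (w ^ n * Cconj (w ^ n))%C = 1).
  { rewrite <- Cmod2_conj. unfold w, om.
    now rewrite !Cmod_pow, Cmod_cis, !pow1. }
  transitivity (Cconj (w ^ n) * (w ^ n * w ^ (K - n)))%C; [rewrite E; ring|].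
  rewrite Cmult_assoc, (Cmult_comm (Cconj _)), E2. ring.
Qed.

(** * Testing a polynomial against the square of another *)

Variables (c u : nat -> C) (M N k : nat) (A : R).
Hypotheses (HN : (1 <= N)%nat) (HNM : (N <= M)%nat) (Hk : (2 * k <= N)%nat)
  (HK : (M + N < K)%nat).

Let G (w : C) : C := Csum (fun i => c i * w ^ i)%C M.
Let W (w : C) : C := Csum (fun i => u i * w ^ (N - i))%C k.

(** The factor w^(K+e-N) stands for w^(e-N), so the mean selects the index i with i + e = N. By [HK]
    all exponents lie strictly between 0 and 2K, hence only the exponent [K] contributes. *)
Lemma root_mean_extract e : (e <= 2 * N)%nat ->
  root_mean (fun w => G w * w ^ (K + e - N))%C =
  if le_dec e N then c (N - e)%nat else 0.
Proof.
  intros He.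
  rewrite (root_mean_ext _ (fun w => Csum (fun i => c i * w ^ (i + (K + e - N)))%C M)).
  2:{ intros j. unfold G. rewrite Cmult_comm, <- Csum_mult_l. apply Csum_ext.
      intros i _. rewrite Cpow_add_r. ring. }
  rewrite root_mean_Csum.
  rewrite (Csum_ext _ (fun i => c i * if Nat.eq_dec (i + e) N then 1 else 0)%C).
  2:{ intros i Hi. rewrite root_mean_scal, root_mean_pow by lia. f_equal.
      destruct (Nat.eq_dec (i + (K + e - N)) 0); [lia|].
      destruct (Nat.eq_dec (i + (K + e - N)) K), (Nat.eq_dec (i + e) N); auto; lia. }
  destruct (le_dec e N) as [H|H].
  - rewrite (Csum_single _ _ (N - e)); [| lia |].
    + destruct (Nat.eq_dec (N - e + e) N); [ring|lia].
    + intros i Hi Hn. destruct (Nat.eq_dec (i + e) N); [lia|ring].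
  - apply Csum_zero. intros i Hi. destruct (Nat.eq_dec (i + e) N); [lia|ring].
Qed.

(** The square is expanded as 1 + 2W + W^2. The constant part extracts c_N and the linear part the
    c_i with i <= k. The quadratic part reaches a coefficient only if i + l >= N, which with i, l <=
    k and 2k <= N forces i = l = k and N = 2k. *)
Lemma root_mean_square :
  root_mean (fun w => G w * w ^ (K - N) * ((1 + W w) * (1 + W w)))%C =
  (c N + 2 * Csum (fun i => u i * c i) k +
   if Nat.eq_dec N (2 * k) then u k * u k * c 0%nat else 0)%C.
Proof.
  rewrite (root_mean_ext _ (fun w =>
    (G w * w ^ (K + 0 - N) +
     Csum (fun i => 2 * u i * (G w * w ^ (K + (N - i) - N))) k) +
     Csum (fun i => Csum (fun l =>
       (u i * u l) * (G w * w ^ (K + (2 * N - i - l) - N))) k) k)%C).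
  2:{ intros j. set (w := (om ^ j)%C).
      replace (Csum (fun i => 2 * u i * (G w * w ^ (K + (N - i) - N))) k)%C
        with (2 * (G w * w ^ (K - N)) * W w)%C.
      2:{ unfold W. rewrite <- Csum_mult_l. apply Csum_ext. intros i Hi.
          replace (K + (N - i) - N)%nat with ((K - N) + (N - i))%nat by lia.
          rewrite Cpow_add_r. ring. }
      replace (Csum (fun i => Csum (fun l =>
         (u i * u l) * (G w * w ^ (K + (2 * N - i - l) - N))) k) k)%C
        with (W w * (G w * w ^ (K - N) * W w))%C.
      2:{ rewrite Cmult_comm. unfold W at 2. rewrite <- Csum_mult_l. apply Csum_ext. intros i Hi.
          rewrite Cmult_comm, Cmult_assoc. unfold W. rewrite <- Csum_mult_l.
          apply Csum_ext. intros l Hl.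
          replace (K + (2 * N - i - l) - N)%nat with ((K - N) + (N - i) + (N - l))%nat by lia.
          rewrite !Cpow_add_r. ring. }
      rewrite Nat.add_0_r. ring. }
  rewrite !root_mean_plus, root_mean_extract by lia.
  destruct (le_dec 0 N) as [_|]; [|lia]. rewrite Nat.sub_0_r, !root_mean_Csum.
  f_equal; [f_equal|].
  - rewrite <- Csum_mult_l. apply Csum_ext. intros i Hi.
    rewrite root_mean_scal, root_mean_extract by lia.
    destruct (le_dec (N - i) N); [|lia].
    replace (N - (N - i))%nat with i by lia. ring.
  (* For i + l < N the exponent 2N - i - l exceeds N, and [root_mean_extract] returns 0. *)
  - assert (Hz : forall i l, (i <= k)%nat -> (l <= k)%nat -> (i + l < N)%nat ->
      root_mean (fun w => (u i * u l) * (G w * w ^ (K + (2 * N - i - l) - N)))%C = 0).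
    { intros i l Hi Hl Hs. rewrite root_mean_scal, root_mean_extract by lia.
      destruct (le_dec (2 * N - i - l) N); [lia|ring]. }
    rewrite (Csum_single _ _ k); [|lia|].
    2:{ intros i Hi Hne. rewrite root_mean_Csum. apply Csum_zero. intros l Hl.
        apply Hz; lia. }
    rewrite root_mean_Csum, (Csum_single _ _ k); [|lia|].
    2:{ intros l Hl Hne. apply Hz; lia. }
    destruct (Nat.eq_dec N (2 * k)) as [E|E]; [|apply Hz; lia].
    rewrite root_mean_scal, root_mean_extract by lia.
    destruct (le_dec (2 * N - k - k) N); [|lia].
    now replace (N - (2 * N - k - k))%nat with 0%nat by lia.
Qed.

(** Parseval for 1 + W. The exponents N - i of W are positive, distinct and below [K], so W and its
    conjugate have mean 0 and only the diagonal of W times its conjugate survives. *)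
Lemma root_mean_norm :
  root_mean (fun w => RtoC (Cmod (1 + W w)%C ^ 2)) =
  RtoC (1 + sum_n (fun i => Cmod (u i) ^ 2) k).
Proof.
  rewrite (root_mean_ext _ (fun w =>
    1 + Csum (fun i => u i * w ^ (N - i)) k +
    Csum (fun i => Cconj (u i) * w ^ (K - (N - i))) k +
    Csum (fun i => Csum (fun l => (u i * Cconj (u l)) * w ^ (K + l - i)) k) k)%C).
  2:{ intros j. set (w := (om ^ j)%C).
      assert (EW : Cconj (W w) = Csum (fun i => Cconj (u i) * w ^ (K - (N - i)))%C k).
      { unfold W. rewrite Cconj_Csum. apply Csum_ext. intros i Hi.
        rewrite Cmult_conj. unfold w. rewrite Cconj_om_pow by lia. reflexivity. }
      replace (Csum (fun i => Csum (fun l =>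
          (u i * Cconj (u l)) * w ^ (K + l - i)) k) k)%C
        with (Cconj (W w) * W w)%C.
      2:{ unfold W at 2. rewrite <- Csum_mult_l. apply Csum_ext. intros i Hi.
          rewrite EW, Cmult_comm, <- Csum_mult_l. apply Csum_ext. intros l Hl.
          replace (K + l - i)%nat with ((N - i) + (K - (N - l)))%nat by lia.
          rewrite Cpow_add_r. ring. }
      rewrite <- EW, Cmod2_conj, Cplus_conj. fold (W w).
      replace (Cconj 1) with (RtoC 1) by (unfold Cconj, RtoC; simpl; f_equal; ring).
      ring. }
  rewrite !root_mean_plus, root_mean_one, !root_mean_Csum.
  rewrite (Csum_zero (fun i => root_mean (fun w => u i * w ^ (N - i))%C)).
  2:{ intros i Hi. rewrite root_mean_scal, root_mean_pow_0 by lia. ring. }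
  rewrite (Csum_zero (fun i => root_mean (fun w => Cconj (u i) * w ^ (K - (N - i)))%C)).
  2:{ intros i Hi. rewrite root_mean_scal, root_mean_pow_0 by lia. ring. }
  rewrite RtoC_plus, RtoC_sum_n.
  transitivity (1 + Csum (fun i => RtoC (Cmod (u i) ^ 2)) k)%C; [|reflexivity].
  rewrite !Cplus_0_r. f_equal. apply Csum_ext. intros i Hi.
  rewrite root_mean_Csum, (Csum_single _ _ i); [|lia|].
  - rewrite root_mean_scal, root_mean_pow by lia.
    destruct (Nat.eq_dec (K + i - i) 0); [lia|].
    destruct (Nat.eq_dec (K + i - i) K); [|lia]. rewrite Cmod2_conj. ring.
  - intros l Hl Hne. rewrite root_mean_scal, root_mean_pow by lia.
    destruct (Nat.eq_dec (K + l - i) 0); [lia|].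
    destruct (Nat.eq_dec (K + l - i) K); [lia|]. ring.
Qed.

(** On the circle |G w^(K-N) (1+W)^2| <= A |1+W|^2; the mean of the left function and that of the
    right bound are the two preceding computations. *)
Lemma polynomial_square_bound :
  (forall x, Cmod (G (cis x)) <= A) ->
  Cmod (c N + 2 * Csum (fun i => u i * c i) k +
    if Nat.eq_dec N (2 * k) then u k * u k * c 0%nat else 0)%C
  <= A * (1 + sum_n (fun i => Cmod (u i) ^ 2) k).
Proof.
  intros HG. rewrite <- root_mean_square.
  eapply Rle_trans.
  - apply Cmod_root_mean_le with (h := fun w => A * Cmod (1 + W w)%C ^ 2).
    intros j. rewrite !Cmod_mult, Cmod_pow.
    replace (Cmod (om ^ j)%C) with 1 by (unfold om; now rewrite Cmod_pow, Cmod_cis, pow1).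
    rewrite pow1. unfold om. rewrite cis_pow.
    specialize (HG (INR j * (2 * PI / INR K))).
    pose proof (pow2_ge_0 (Cmod (1 + W (cis (INR j * (2 * PI / INR K)))))). simpl in *. nra.
  - right. rewrite (root_mean_ext _ (fun w => RtoC A * RtoC (Cmod (1 + W w)%C ^ 2))%C).
    + rewrite root_mean_scal, root_mean_norm, <- RtoC_mult. reflexivity.
    + intros j. apply RtoC_mult.
Qed.

End RootMean.

(** * Coefficients of bounded functions *)

(** With g(w) = sum b_n w^n this says |z^m g(z^p)| <= 1 on the disc. The factor |z|^m is carried
    along and disappears when the radius tends to 1. *)
Definition disc_bounded (p m : nat) (b : nat -> C) : Prop :=
  forall z : C, unit_disc z -> exists s : C,
    is_series (K := C_AbsRing) (V := C_NormedModule)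
      (fun n => b n * z ^ (n * p))%C s /\ Cmod z ^ m * Cmod s <= 1.

Lemma disc_bounded_rotate p m b (e : C) :
  Cmod e = 1 -> disc_bounded p m b -> disc_bounded p m (fun n => e * b n)%C.
Proof.
  intros He H z Hz. destruct (H z Hz) as [s [Hs Hb]].
  exists (e * s)%C. split; [|now rewrite Cmod_mult, He, Rmult_1_l].
  eapply is_series_ext; [|exact (is_series_scal (V := C_NormedModule) e _ _ Hs)].
  intros n. apply Cmult_assoc.
Qed.

Lemma pow_lt_1_base (x : R) n : 0 <= x < 1 -> (1 <= n)%nat -> 0 <= x ^ n < 1.
Proof.
  intros [H0 H1] Hn. split; [now apply pow_le|].
  destruct n as [|n]; [lia|]. simpl.
  assert (0 <= x ^ n <= 1); [|nra].
  split; [now apply pow_le|]. rewrite <- (pow1 n). apply pow_incr; lra.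
Qed.

(** Convergence at a radius t' > t bounds the terms there, and the terms at t are then dominated by
    a geometric series of ratio (t/t')^p. *)
Lemma disc_bounded_summable p m b t : (1 <= p)%nat -> disc_bounded p m b ->
  0 < t < 1 -> ex_series (fun n => Cmod (b n) * (t ^ p) ^ n).
Proof.
  intros Hp H Ht. set (t' := (t + 1) / 2).
  assert (Ht' : t < t' < 1) by (unfold t'; lra).
  destruct (H (RtoC t')) as [s [Hs _]].
  { unfold unit_disc. rewrite Cmod_R, Rabs_pos_eq; lra. }
  destruct (filterlim_bounded (V := C_NormedModule) _ (ex_intro _ s Hs)) as [M HM].
  set (a := fun n => (b n * RtoC t' ^ (n * p))%C) in *.
  (* Each term after the first is a difference of two partial sums, both bounded by [M]. *)
  assert (Ha : forall n, Cmod (a n) <= 2 * M).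
  { intros [|n].
    - specialize (HM 0%nat). rewrite sum_O in HM. pose proof (norm_ge_0 (a 0%nat)).
      change (norm (a 0%nat) <= 2 * M). lra.
    - pose proof (HM n) as H1. pose proof (HM (S n)) as H2.
      change (Cmod (Csum a n) <= M) in H1. change (Cmod (Csum a (S n)) <= M) in H2.
      replace (a (S n)) with (Csum a (S n) + - Csum a n)%C by (rewrite Csum_S; ring).
      eapply Rle_trans; [apply Cmod_triangle|]. rewrite Cmod_opp. lra. }
  set (q := (t / t') ^ p).
  assert (Hq : 0 <= q < 1).
  { apply pow_lt_1_base; [|assumption]. split; [apply Rdiv_le_0_compat; lra|].
    apply (Rmult_lt_reg_r t'); [lra|]. field_simplify; lra. }
  assert (Hg : ex_series (fun n => (2 * M) * q ^ n)).
  { apply (ex_series_scal (2 * M) (fun n => q ^ n)). apply ex_series_geom.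
    rewrite Rabs_pos_eq; lra. }
  refine (ex_series_le (V := R_CompleteNormedModule) _ _ _ Hg).
  intros n. change (Rabs (Cmod (b n) * (t ^ p) ^ n) <= 2 * M * q ^ n).
  rewrite Rabs_pos_eq
    by (apply Rmult_le_pos; [apply Cmod_ge_0|apply pow_le, pow_le; lra]).
  replace (Cmod (b n) * (t ^ p) ^ n) with (Cmod (a n) * q ^ n).
  - apply Rmult_le_compat_r; [apply pow_le; lra|apply Ha].
  - unfold a, q. rewrite Cmod_mult, Cmod_pow, Cmod_R, Rabs_pos_eq by lra.
    unfold Rdiv. rewrite !Rpow_mult_distr, !pow_inv, (Nat.mul_comm n p), <- !pow_mult.
    field. apply pow_nonzero; lra.
Qed.

(** The threshold [M0] comes from the series of absolute values, so it serves all x at once. *)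
Lemma disc_bounded_circle p m b t eps : (1 <= p)%nat -> disc_bounded p m b ->
  0 < t < 1 -> 0 < eps -> exists M0, forall M x, (M0 <= M)%nat ->
  Cmod (Csum (fun i => (b i * RtoC (t ^ p) ^ i) * cis x ^ i)%C M) <= / t ^ m + eps.
Proof.
  intros Hp H Ht He.
  pose proof (disc_bounded_summable p m b t Hp H Ht) as Hs.
  assert (He2 : 0 < eps / 2) by lra.
  apply (Cauchy_ex_series (V := R_CompleteNormedModule)) in Hs.
  destruct (Hs (mkposreal _ He2)) as [M0 HM0]. exists M0. intros M x HM.
  (* A point with z^p = t^p cis x, so that the lacunary series at z is the power series at t^p cis
     x. *)
  set (z := (RtoC t * cis (x / INR p))%C).
  assert (Hz : Cmod z = t).
  { unfold z. rewrite Cmod_mult, Cmod_cis, Cmod_R, Rabs_pos_eq; lra. }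
  destruct (H z) as [s [Hser Hb]]; [unfold unit_disc; lra|].
  set (u := fun i => ((b i * RtoC (t ^ p) ^ i) * cis x ^ i)%C).
  assert (Hu : forall n, (b n * z ^ (n * p))%C = u n).
  { intros n. unfold u, z. rewrite Nat.mul_comm, Cpow_mult_r, (Cpow_mult_l _ _ p), RtoC_pow.
    rewrite (cis_pow _ p).
    replace (INR p * (x / INR p)) with x by (field; apply not_0_INR; lia).
    rewrite Cpow_mult_l. ring. }
  apply (is_series_ext _ u) in Hser; [|exact Hu].
  destruct (proj1 (filterlim_locally_ball_norm (U := C_NormedModule) _ s) Hser
    (mkposreal _ He2)) as [n0 Hn0].
  (* [n] may depend on x: the partial sum up to [n] is close to the limit s, and the block from [M]
     to [n] is small uniformly in x. *)
  set (n := S (Nat.max n0 M)).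
  specialize (Hn0 n ltac:(lia)). change (Cmod (Csum u n - s)%C < eps / 2) in Hn0.
  assert (Htail : Cmod (Csum u n - Csum u M)%C <= eps / 2).
  { specialize (HM0 (S M) n ltac:(lia) ltac:(lia)). simpl in HM0.
    apply Rlt_le in HM0. eapply Rle_trans; [|exact HM0].
    eapply Rle_trans; [|apply Rle_abs].
    change (Csum u n - Csum u M)%C
      with (minus (G := C_NormedModule) (sum_n (G := C_NormedModule) u n) (sum_n (G := C_NormedModule) u M)).
    rewrite <- (sum_n_m_sum_n (G := C_NormedModule)) by lia.
    eapply Rle_trans; [apply (norm_sum_n_m (V := C_NormedModule))|].
    right. apply sum_n_m_ext. intros i.
    change (Cmod (u i) = Cmod (b i) * (t ^ p) ^ i). unfold u.
    rewrite !Cmod_mult, !Cmod_pow, Cmod_cis, pow1, Cmod_R, Rabs_pos_eq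
      by (apply pow_le; lra). ring. }
  assert (Hsb : Cmod s <= / t ^ m).
  { rewrite Hz in Hb. assert (0 < t ^ m) by (apply pow_lt; lra).
    apply (Rmult_le_reg_l (t ^ m)); [assumption|]. rewrite Rinv_r; lra. }
  replace (Csum u M) with (s + ((Csum u n - s) + - (Csum u n - Csum u M)))%C by ring.
  eapply Rle_trans; [apply Cmod_triangle|].
  eapply Rle_trans; [apply Rplus_le_compat_l, Cmod_triangle|].
  rewrite Cmod_opp. lra.
Qed.

Lemma le_of_continuous_left (h : R -> R) B :
  continuous h 1 -> (forall t, 0 < t < 1 -> h t <= B) -> h 1 <= B.
Proof.
  intros Hc H. apply Rnot_lt_le. intros Hlt.
  assert (He : 0 < h 1 - B) by lra.
  destruct (proj1 (filterlim_locally _ _) Hc (mkposreal _ He)) as [d Hd].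
  (* The maximum with 1/2 keeps t positive; in either case t is within d/2 of 1. *)
  set (t := Rmax (1 / 2) (1 - d / 2)).
  pose proof (cond_pos d).
  assert (Ht : 1 - d / 2 <= t < 1 /\ 1 / 2 <= t).
  { unfold t. split; [split; [apply Rmax_r|apply Rmax_lub_lt; lra]|apply Rmax_l]. }
  assert (Hb : ball 1 d t).
  { change (Rabs (t - 1) < d). apply Rabs_def1; lra. }
  specialize (Hd t Hb). change (Rabs (h t - h 1) < h 1 - B) in Hd.
  apply Rabs_def2 in Hd. specialize (H t ltac:(lra)). lra.
Qed.

Lemma Re_plus (x y : C) : Re (x + y)%C = Re x + Re y.
Proof. reflexivity. Qed.

Lemma Re_RtoC (r : R) : Re r = r.
Proof. reflexivity. Qed.

Lemma Re_scal (r : R) (x : C) : Re (r * x)%C = r * Re x.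
Proof. unfold Re, RtoC, Cmult; cbn [fst snd]. ring. Qed.

(** The polynomial inequality is applied to the coefficients b_i t^(pi) for t < 1, with the circle
    bound t^(-m) + eps; first eps tends to 0, then t to 1. *)
Lemma disc_bounded_square_bound p m b (u : nat -> C) N k :
  (1 <= p)%nat -> disc_bounded p m b -> (1 <= N)%nat -> (2 * k <= N)%nat ->
  Re (b N + 2 * Csum (fun i => u i * b i) k +
    if Nat.eq_dec N (2 * k) then u k * u k * b 0%nat else 0)%C
  <= 1 + sum_n (fun i => Cmod (u i) ^ 2) k.
Proof.
  intros Hp H HN Hk. set (B := 1 + sum_n _ k).
  assert (HB : 0 < B).
  { assert (0 <= sum_n (fun i => Cmod (u i) ^ 2) k); [|unfold B; lra].
    apply sum_n_nonneg. intros; apply pow2_ge_0. }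
  set (kap := if Nat.eq_dec N (2 * k) then (u k * u k * b 0%nat)%C else RtoC 0).
  (* The left side for the coefficients b_i t^(pi), multiplied by t^m to clear the bound t^(-m). It
     is a polynomial in t, and its value at 1 is the expression of the claim. *)
  set (h := fun t : R => t ^ m * (Re (b N) * (t ^ p) ^ N +
    2 * sum_n (fun i => Re (u i * b i)%C * (t ^ p) ^ i) k + Re kap)).
  assert (Eh : h 1 = Re (b N + 2 * Csum (fun i => u i * b i) k + kap)%C).
  { unfold h. rewrite !pow1.
    rewrite (sum_n_ext _ (fun i => Re (u i * b i)%C)) by (intros; rewrite pow1; apply Rmult_1_r).
    rewrite <- Re_Csum, !Re_plus, Re_scal. ring. }
  rewrite <- Eh. apply le_of_continuous_left.
  - apply (ex_derive_continuous h). unfold h.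
    apply ex_derive_mult; [auto_derive; exact I|].
    apply (ex_derive_plus (V := R_NormedModule)); [|auto_derive; exact I].
    apply (ex_derive_plus (V := R_NormedModule)); [auto_derive; exact I|].
    apply ex_derive_mult; [auto_derive; exact I|].
    refine (ex_derive_sum_n (K := R_AbsRing) (V := R_NormedModule)
      (fun i t => Re (u i * b i)%C * (t ^ p) ^ i) k 1 _).
    intros; auto_derive; exact I.
  - intros t Ht. assert (Htm : 0 < t ^ m) by (apply pow_lt; lra).
    set (c := fun i => (b i * RtoC (t ^ p) ^ i)%C).
    assert (Hc : Cmod (c N + 2 * Csum (fun i => u i * c i) k +
        if Nat.eq_dec N (2 * k) then u k * u k * c 0%nat else 0)%C <= / t ^ m * B).
    { apply le_epsilon. intros eps He.
      assert (He' : 0 < eps / B) by now apply Rdiv_lt_0_compat.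
      destruct (disc_bounded_circle p m b t _ Hp H Ht He') as [M0 HM0].
      set (M := (M0 + N)%nat).
      replace (/ t ^ m * B + eps) with ((/ t ^ m + eps / B) * B)
        by (field; split; lra).
      (* The argument M + N means M + N + 1 roots of unity, just enough for [HK]. *)
      apply (polynomial_square_bound (M + N) c u M); try lia.
      intros x. apply HM0. lia. }
    apply (Rmult_le_reg_l (/ t ^ m)); [now apply Rinv_0_lt_compat|].
    eapply Rle_trans; [|exact Hc]. eapply Rle_trans; [|apply re_le_Cmod].
    eapply Rle_trans; [|apply Rle_abs]. right. unfold h.
    rewrite <- Rmult_assoc, Rinv_l, Rmult_1_l by lra.
    assert (Ec : forall x i, Re (x * c i)%C = Re (x * b i)%C * (t ^ p) ^ i).
    { intros x i. unfold c. rewrite Cmult_assoc, <- RtoC_pow, Cmult_comm, Re_scal. ring. }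
    rewrite (sum_n_ext _ (fun i => Re (u i * c i)%C)) by (intros; now rewrite Ec).
    rewrite <- Re_Csum, !Re_plus, Re_scal. unfold kap.
    rewrite <- (Cmult_1_l (c N)), Ec, Cmult_1_l.
    destruct (Nat.eq_dec N (2 * k)); [rewrite Ec|]; simpl; ring.
Qed.

(** A unimodular factor makes a chosen coefficient real and nonnegative, so that its real part is
    its modulus. *)
Lemma rotation_to_Cmod (z : C) : exists e : C, Cmod e = 1 /\ (e * z)%C = RtoC (Cmod z).
Proof.
  destruct (Ceq_dec z 0) as [->|Hz].
  - exists (RtoC 1). rewrite Cmod_0, Cmod_1. split; [reflexivity|ring].
  - pose proof (proj1 (Cmod_gt_0 z) Hz) as Hpos.
    assert (Hne : RtoC (Cmod z) <> 0) by (intros E; apply RtoC_inj in E; lra).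
    exists (Cconj z / RtoC (Cmod z))%C. split.
    + rewrite Cmod_div, Cmod_conj, Cmod_R, Rabs_pos_eq by (lra || exact Hne).
      field. lra.
    + transitivity ((z * Cconj z) / RtoC (Cmod z))%C; [field; exact Hne|].
      rewrite <- Cmod2_conj. simpl. rewrite RtoC_mult. rewrite Rmult_1_r. field. exact Hne.
Qed.

Lemma Re_conj_sum (b : nat -> C) k :
  Re (Csum (fun i => Cconj (b i) * b i)%C k) = sum_n (fun i => Cmod (b i) ^ 2) k.
Proof.
  rewrite Re_Csum. apply sum_n_ext. intros i. now rewrite Cmult_comm, <- Cmod2_conj.
Qed.

(** Take N = 2k + 1 and u_i = conj b_i after a rotation making b_N nonnegative. With S the sum of
    the squares, the square bound reads |b_N| + 2S <= 1 + S. *)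
Lemma coef_bound_odd p m b k : (1 <= p)%nat -> disc_bounded p m b ->
  Cmod (b (2 * k + 1)%nat) + sum_n (fun i => Cmod (b i) ^ 2) k <= 1.
Proof.
  intros Hp H. destruct (rotation_to_Cmod (b (2 * k + 1)%nat)) as [e [He Eb]].
  apply (disc_bounded_rotate _ _ _ e He) in H.
  pose proof (disc_bounded_square_bound p m _ (fun i => Cconj (e * b i)%C)
    (2 * k + 1) k Hp H ltac:(lia) ltac:(lia)) as K.
  destruct (Nat.eq_dec (2 * k + 1) (2 * k)) as [F|_]; [lia|].
  rewrite Eb in K.
  rewrite (sum_n_ext _ (fun i => Cmod (b i) ^ 2)) in K
    by (intros; now rewrite Cmod_conj, Cmod_mult, He, Rmult_1_l).
  pose proof (Re_conj_sum (fun i => e * b i)%C k) as E. cbv beta in E.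
  rewrite (sum_n_ext _ (fun i => Cmod (b i) ^ 2)) in E
    by (intros; now rewrite Cmod_mult, He, Rmult_1_l).
  rewrite !Re_plus, Re_scal, !Re_RtoC, E in K. lra.
Qed.

(** Here N = 2k + 2, so the last index k + 1 also produces the term u_(k+1)^2 b_0. The earlier u_i
    are conj b_i, while u_(k+1) has modulus q and the phase making u_(k+1) b_(k+1) nonnegative. *)
Lemma coef_bound_even p m b k : (1 <= p)%nat -> disc_bounded p m b ->
  Cmod (b (2 * k + 2)%nat) + sum_n (fun i => Cmod (b i) ^ 2) k +
  Cmod (b (S k)) ^ 2 / (1 + Cmod (b 0%nat)) <= 1.
Proof.
  intros Hp H. destruct (rotation_to_Cmod (b (2 * k + 2)%nat)) as [e [He Eb]].
  apply (disc_bounded_rotate _ _ _ e He) in H.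
  set (b' := fun n => (e * b n)%C) in *.
  assert (Hb' : forall n, Cmod (b' n) = Cmod (b n)).
  { intros n. unfold b'. now rewrite Cmod_mult, He, Rmult_1_l. }
  destruct (rotation_to_Cmod (b' (S k))) as [e2 [He2 Eb2]]. rewrite Hb' in Eb2.
  pose proof (Cmod_ge_0 (b 0%nat)) as H0.
  pose proof (Cmod_ge_0 (b (S k))) as H1.
  (* This q maximises 2 q |b_(k+1)| - q^2 (1 + |b_0|), with maximum |b_(k+1)|^2 / (1 + |b_0|). *)
  set (q := Cmod (b (S k)) / (1 + Cmod (b 0%nat))).
  assert (Hq : 0 <= q) by (apply Rdiv_le_0_compat; lra).
  set (u := fun i => if le_dec i k then Cconj (b' i) else (RtoC q * e2)%C).
  assert (Hu : u (S k) = (RtoC q * e2)%C).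
  { unfold u. destruct (le_dec (S k) k); [lia|reflexivity]. }
  pose proof (disc_bounded_square_bound p m _ u (2 * k + 2) (S k) Hp H
    ltac:(lia) ltac:(lia)) as K.
  destruct (Nat.eq_dec (2 * k + 2) (2 * S k)) as [_|F]; [|lia].
  rewrite Csum_S, sum_Sn, Hu in K.
  rewrite (Csum_ext _ (fun i => Cconj (b' i) * b' i)%C) in K.
  2:{ intros i Hi. unfold u. destruct (le_dec i k); [reflexivity|lia]. }
  rewrite (sum_n_ext_loc _ (fun i => Cmod (b i) ^ 2)) in K.
  2:{ intros i Hi. unfold u. destruct (le_dec i k); [|lia]. now rewrite Cmod_conj, Hb'. }
  replace (RtoC q * e2 * b' (S k))%C with (RtoC (q * Cmod (b (S k)))) in K
    by (rewrite <- Cmult_assoc, Eb2, <- RtoC_mult; reflexivity).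
  replace (b' (2 * k + 2)%nat) with (RtoC (Cmod (b (2 * k + 2)%nat))) in K
    by (symmetry; exact Eb).
  rewrite Cmod_mult, He2, Cmod_R, (Rabs_pos_eq q), Rmult_1_r in K by assumption.
  pose proof (Re_conj_sum b' k) as E.
  rewrite (sum_n_ext _ (fun i => Cmod (b i) ^ 2)) in E by (intros; now rewrite Hb').
  set (x := (RtoC q * e2 * (RtoC q * e2) * b' 0%nat)%C) in K.
  (* The phase of u_(k+1)^2 b_0 is not controlled, so its real part is estimated by its modulus. *)
  assert (Hx : - (q ^ 2 * Cmod (b 0%nat)) <= Re x).
  { pose proof (re_le_Cmod x) as Hr. unfold x in Hr at 2.
    rewrite !Cmod_mult, He2, Cmod_R, Hb', (Rabs_pos_eq q) in Hr by assumption.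
    apply Rabs_le_between in Hr. nra. }
  assert (K' : Cmod (b (2 * k + 2)%nat) +
    2 * (sum_n (fun i => Cmod (b i) ^ 2) k + q * Cmod (b (S k))) + Re x <=
    1 + (sum_n (fun i => Cmod (b i) ^ 2) k + q ^ 2)).
  { rewrite <- E. eapply Rle_trans; [|eapply Rle_trans; [exact K|]].
    - right. rewrite !Re_plus, Re_scal, Re_plus, !Re_RtoC. ring.
    - right. rewrite E. reflexivity. }
  assert (Eq : Cmod (b (S k)) ^ 2 / (1 + Cmod (b 0%nat)) =
    2 * (q * Cmod (b (S k))) - q ^ 2 * (1 + Cmod (b 0%nat))).
  { unfold q. field. lra. }
  rewrite Eq. nra.
Qed.

(** * Series *)

Lemma ex_series_dominated (u v : nat -> R) :
  (forall n, Rabs (u n) <= v n) -> ex_series v -> ex_series u.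
Proof. exact (ex_series_le (V := R_CompleteNormedModule) u v). Qed.

Lemma is_series_Rabs_le (u v : nat -> R) l :
  is_series u l -> (forall n, Rabs (u n) <= v n) -> ex_series v ->
  Rabs l <= Series v.
Proof.
  intros Hu H Hv.
  assert (Ha : ex_series (fun n => Rabs (u n))).
  { apply (ex_series_dominated _ v); [|assumption]. intros n. now rewrite Rabs_Rabsolu. }
  rewrite <- (is_series_unique u l Hu).
  eapply Rle_trans; [now apply Series_Rabs|].
  apply Series_le; [|assumption]. intros n. split; [apply Rabs_pos|apply H].
Qed.

Lemma Series_nonneg (u : nat -> R) :
  (forall n, 0 <= u n) -> ex_series u -> 0 <= Series u.
Proof.
  intros H Hu. eapply Rle_trans; [apply (Rabs_pos (Series u))|].
  apply (is_series_Rabs_le u); [now apply Series_correct| |assumption].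
  intros n. rewrite Rabs_pos_eq by apply H. lra.
Qed.

(** The partial sums of the paired series are the partial sums of odd index of the original one. *)
Lemma is_series_pairs (u : nat -> R) l :
  is_series u l -> is_series (fun k => u (2 * k)%nat + u (2 * k + 1)%nat) l.
Proof.
  intros H.
  assert (E : forall n, sum_n u (2 * n + 1) =
    sum_n (fun k => u (2 * k)%nat + u (2 * k + 1)%nat) n).
  { induction n as [|n IH].
    - change (2 * 0 + 1)%nat with 1%nat. now rewrite sum_Sn, !sum_O.
    - replace (2 * S n + 1)%nat with (S (S (2 * n + 1))) by lia.
      rewrite !sum_Sn, IH.
      replace (S (S (2 * n + 1))) with (2 * S n + 1)%nat by lia.
      replace (S (2 * n + 1)) with (2 * S n)%nat by lia.
      exact (Rplus_assoc _ _ _). }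
  change (is_lim_seq (sum_n (fun k => u (2 * k)%nat + u (2 * k + 1)%nat)) l).
  eapply is_lim_seq_ext; [exact E|].
  apply (is_lim_seq_subseq (sum_n u) l (fun n => (2 * n + 1)%nat)); [|exact H].
  apply eventually_subseq. intros n. lia.
Qed.

Lemma ex_series_from (z : nat -> R) n :
  ex_series z -> ex_series (fun j => z (n + j)%nat).
Proof. exact (proj1 (ex_series_incr_n z n)). Qed.

Lemma Series_from_S (z : nat -> R) n :
  ex_series z -> Series_from n z = z n + Series_from (S n) z.
Proof.
  intros H. unfold Series_from. rewrite Series_incr_1 by now apply ex_series_from.
  rewrite Nat.add_0_r. f_equal. apply Series_ext. intros j. f_equal. lia.
Qed.

Lemma Series_from_S_sum (z : nat -> R) n :
  ex_series z -> Series_from (S n) z = Series z - sum_n z n.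
Proof.
  intros H. assert (E0 : Series z = Series_from 0 z) by reflexivity.
  induction n as [|n IH].
  - rewrite E0, (Series_from_S z 0), sum_O by assumption. ring.
  - rewrite (Series_from_S z (S n) H) in IH. rewrite sum_Sn.
    change (plus (sum_n z n) (z (S n))) with (sum_n z n + z (S n)). lra.
Qed.

(* Summation by parts: the partial sums of the two series differ by
   [sum_n q n * Series_from (S n) z], which tends to 0. *)
Lemma is_series_weighted_tails (q z : nat -> R) Q :
  (forall n, 0 <= z n) -> ex_series z -> (forall n, 0 <= q n) ->
  (forall n, sum_n q n <= Q) ->
  ex_series (fun k => z k * sum_n q k) /\
  is_series (fun n => q n * Series_from n z) (Series (fun k => z k * sum_n q k)).
Proof.
  intros Hz Hez Hq HQ.
  assert (HS : forall n, 0 <= sum_n q n).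
  { intros n. now apply sum_n_nonneg. }
  assert (He : ex_series (fun k => z k * sum_n q k)).
  { apply (ex_series_dominated _ (fun k => z k * Q)).
    - intros k. specialize (Hz k). specialize (HS k). specialize (HQ k).
      rewrite Rabs_pos_eq by (apply Rmult_le_pos; assumption). nra.
    - now apply ex_series_scal_r. }
  split; [exact He|].
  assert (E : forall n, sum_n (fun k => z k * sum_n q k) n + sum_n q n * Series_from (S n) z =
    sum_n (fun n => q n * Series_from n z) n).
  { induction n as [|n IH].
    - rewrite !sum_O, (Series_from_S z 0) by assumption. ring.
    - rewrite !sum_Sn, <- IH.
      repeat change (@plus R_AbelianMonoid ?a ?b) with (a + b).
      rewrite (Series_from_S z (S n)) by assumption. ring. }
  change (is_lim_seq (sum_n (fun n => q n * Series_from n z))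
    (Series (fun k => z k * sum_n q k))).
  eapply is_lim_seq_ext; [exact E|].
  rewrite <- (Rplus_0_r (Series _)).
  apply (is_lim_seq_plus' _ _ _ 0); [exact (Series_correct _ He)|].
  assert (HT : is_lim_seq (fun n => Series z - sum_n z n) 0).
  { replace 0 with (Series z - Series z) by ring.
    apply is_lim_seq_minus'; [apply is_lim_seq_const|exact (Series_correct _ Hez)]. }
  apply (is_lim_seq_le_le (fun _ => 0) _ (fun n => Q * (Series z - sum_n z n))).
  - intros n. rewrite <- Series_from_S_sum by assumption.
    assert (0 <= Series_from (S n) z).
    { apply Series_nonneg; [intros; apply Hz|now apply ex_series_from]. }
    specialize (HS n). specialize (HQ n). split; [now apply Rmult_le_pos|nra].
  - apply is_lim_seq_const.
  - rewrite <- (Rmult_0_r Q). now apply (is_lim_seq_scal_l _ Q 0).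
Qed.

(** * Rearrangement of the refined sums into series over index pairs *)

Section Refined.
Variables (Z be : nat -> R).
Hypotheses (HZ : forall n, 0 <= Z n) (HeZ : ex_series Z)
  (Hbe : forall n, 0 <= be n <= 1) (HS : forall n, sum_n (fun i => be i ^ 2) n <= 1).

Lemma ex_series_reindex (g : nat -> nat) : (forall k, g k = (2 * k + 1)%nat \/ g k = (2 * k + 2)%nat) ->
  ex_series (fun k => Z (g k)).
Proof.
  intros Hg.
  assert (Hp : ex_series (fun k => Z (2 * k + 1)%nat + Z (2 * k + 2)%nat)).
  { destruct (ex_series_from Z 1 HeZ) as [l Hl]. exists l.
    eapply is_series_ext; [|exact (is_series_pairs _ _ Hl)].
    intros k. cbv beta. f_equal; f_equal; lia. }
  apply (ex_series_dominated _ _) with (2 := Hp). intros k.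
  rewrite Rabs_pos_eq by apply HZ.
  pose proof (HZ (2 * k + 1)%nat). pose proof (HZ (2 * k + 2)%nat).
  destruct (Hg k) as [-> | ->]; lra.
Qed.

(** Here [be n] stands for |b_n|, [Z n] for the n-th monomial at r^p and [s n] for the sign. The
    terms are dominated by [Z]; they are then grouped into the pairs (2k+1, 2k+2). *)
Lemma is_series_linear_part (s : nat -> R) : (forall n, (1 <= n)%nat -> Rabs (s n) <= 1) ->
  is_series (fun k => s (2 * k + 1)%nat * be (2 * k + 1)%nat * Z (2 * k + 1)%nat +
     s (2 * k + 2)%nat * be (2 * k + 2)%nat * Z (2 * k + 2)%nat)
    (Series_from 1 (fun n => s n * be n * Z n)).
Proof.
  intros Hs.
  assert (He : ex_series (fun j => s (1 + j)%nat * be (1 + j)%nat * Z (1 + j)%nat)).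
  { apply (ex_series_dominated _ (fun j => Z (1 + j)%nat)); [|now apply ex_series_from].
    intros j. rewrite !Rabs_mult, (Rabs_pos_eq (be _)), (Rabs_pos_eq (Z _)) by (apply HZ || apply Hbe).
    specialize (Hs (1 + j)%nat ltac:(lia)). pose proof (Hbe (1 + j)%nat) as [Hb0 Hb1].
    pose proof (HZ (1 + j)%nat). pose proof (Rabs_pos (s (1 + j)%nat)).
    assert (Rabs (s (1 + j)%nat) * be (1 + j)%nat <= 1) by nra. nra. }
  eapply is_series_ext; [|exact (is_series_pairs _ _ (Series_correct _ He))].
  intros k. cbv beta.
  replace (1 + 2 * k)%nat with (2 * k + 1)%nat by lia.
  now replace (1 + (2 * k + 1))%nat with (2 * k + 2)%nat by lia.
Qed.

(** Summation by parts with weights be_n^2 and z_k = Z_(2k+1) turns the double sum into the sum of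
    the Z_(2k+1) sum_(i<=k) be_i^2, which is added to the paired linear part. *)
Lemma is_series_alternating (s : nat -> R) sigma : Rabs sigma = 1 ->
  (forall k, s (2 * k + 1)%nat = sigma) -> (forall k, s (2 * k + 2)%nat = - sigma) ->
  is_series (fun k => sigma *
      (Z (2 * k + 1)%nat * (be (2 * k + 1)%nat + sum_n (fun i => be i ^ 2) k) -
       be (2 * k + 2)%nat * Z (2 * k + 2)%nat))
    (Series_from 1 (fun n => s n * be n * Z n) +
     sigma * Series_from 0 (fun n => be n ^ 2 * Series_from n (fun k => Z (2 * k + 1)%nat))).
Proof.
  intros Hsig Hodd Heven.
  assert (Hs : forall n, (1 <= n)%nat -> Rabs (s n) <= 1).
  { intros n Hn. right. destruct (Nat.Even_or_Odd n) as [[j E]|[j E]]; subst.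
    - replace (2 * j)%nat with (2 * (j - 1) + 2)%nat by lia.
      now rewrite Heven, Rabs_Ropp.
    - now rewrite Hodd. }
  destruct (is_series_weighted_tails (fun n => be n ^ 2) (fun k => Z (2 * k + 1)%nat) 1)
    as [He Hw].
  - intros; apply HZ.
  - apply ex_series_reindex. now left.
  - intros; apply pow2_ge_0.
  - exact HS.
  - replace (Series_from 0 _) with (Series (fun k => Z (2 * k + 1)%nat * sum_n (fun i => be i ^ 2) k))
      by (symmetry; exact (is_series_unique _ _ Hw)).
    eapply is_series_ext; [|exact (is_series_plus _ _ _ _ (is_series_linear_part s Hs)
      (is_series_scal_l sigma _ _ (Series_correct _ He)))].
    intros k. cbv beta. rewrite Hodd, Heven.
    change (sigma * be (2 * k + 1)%nat * Z (2 * k + 1)%nat +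
      - sigma * be (2 * k + 2)%nat * Z (2 * k + 2)%nat +
      sigma * (Z (2 * k + 1)%nat * sum_n (fun i => be i ^ 2) k) =
      sigma * (Z (2 * k + 1)%nat * (be (2 * k + 1)%nat + sum_n (fun i => be i ^ 2) k) -
       be (2 * k + 2)%nat * Z (2 * k + 2)%nat)). ring.
Qed.

(** The tail of [Z] from 2n + 1 is the tail from n of the pair sums [z], so summation by parts
    applies to [z]. The term with Z_(2n) is placed at n = k + 1, next to be_(2k+2). *)
Lemma is_series_constant_sign (s : nat -> R) sigma : Rabs sigma = 1 ->
  (forall n, (1 <= n)%nat -> s n = sigma) ->
  is_series (fun k => sigma *
      (Z (2 * k + 1)%nat * (be (2 * k + 1)%nat + (sum_n (fun i => be i ^ 2) k - be 0%nat ^ 2)) +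
       Z (2 * k + 2)%nat * (be (2 * k + 2)%nat + (sum_n (fun i => be i ^ 2) k - be 0%nat ^ 2) +
         be (S k) ^ 2 / (1 + be 0%nat))))
    (Series_from 1 (fun n => s n * be n * Z n) +
     sigma * Series_from 1 (fun n => be n ^ 2 *
       (Z (2 * n)%nat / (1 + be 0%nat) + Series_from (2 * n + 1) Z))).
Proof.
  intros Hsig Hs1.
  assert (Hs : forall n, (1 <= n)%nat -> Rabs (s n) <= 1).
  { intros n Hn. rewrite Hs1 by assumption. lra. }
  (* The weight at 0 is set to 0 because the quadratic sum starts at n = 1; this is the source of
     the subtracted be_0^2. *)
  set (q := fun n => if Nat.eq_dec n 0 then 0 else be n ^ 2).
  set (z := fun k => Z (2 * k + 1)%nat + Z (2 * k + 2)%nat).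
  assert (Hq : forall n, sum_n q n = sum_n (fun i => be i ^ 2) n - be 0%nat ^ 2).
  { induction n as [|n IH]; [rewrite !sum_O; unfold q; simpl; ring|].
    rewrite !sum_Sn, IH.
    repeat change (@plus R_AbelianMonoid ?a ?b) with (a + b).
    unfold q. simpl. ring. }
  assert (Hez : ex_series z).
  { apply (ex_series_plus (V := R_NormedModule)); apply ex_series_reindex; auto. }
  destruct (is_series_weighted_tails q z 1) as [He Hw].
  - intros k. unfold z. pose proof (HZ (2 * k + 1)%nat). pose proof (HZ (2 * k + 2)%nat). lra.
  - exact Hez.
  - intros n. unfold q. destruct (Nat.eq_dec n 0); [lra|apply pow2_ge_0].
  - intros n. rewrite Hq. specialize (HS n). pose proof (pow2_ge_0 (be 0%nat)). lra.
  - assert (Htail : forall n, Series_from (2 * n + 1) Z = Series_from n z).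
    { intros n. symmetry. apply is_series_unique.
      eapply is_series_ext; [|exact (is_series_pairs _ _ (Series_correct _ (ex_series_from Z (2 * n + 1) HeZ)))].
      intros k. unfold z. f_equal; f_equal; lia. }
    set (L := Series (fun k => z k * sum_n q k)) in *.
    (* The shift to start at 1 leaves the sum unchanged since q_0 = 0. *)
    assert (Hw1 : is_series (fun j => q (S j) * Series_from (S j) z) L).
    { apply (is_series_incr_1 (fun n => q n * Series_from n z)).
      change (is_series (fun n => q n * Series_from n z) (L + q 0%nat * Series_from 0 z)).
      replace (L + q 0%nat * Series_from 0 z) with L by (unfold q; simpl; ring).
      exact Hw. }
    assert (Hv : ex_series (fun j => be (S j) ^ 2 * (Z (2 * j + 2)%nat / (1 + be 0%nat)))).
    { apply (ex_series_dominated _ (fun j => Z (2 * j + 2)%nat));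
        [|apply ex_series_reindex; now right].
      intros j. pose proof (HZ (2 * j + 2)%nat) as Hz. pose proof (Hbe 0%nat).
      pose proof (Hbe (S j)).
      assert (0 <= Z (2 * j + 2)%nat / (1 + be 0%nat) <= Z (2 * j + 2)%nat).
      { split; [apply Rdiv_le_0_compat; lra|].
        apply (Rmult_le_reg_r (1 + be 0%nat)); [lra|]. field_simplify; nra. }
      assert (0 <= be (S j) ^ 2 <= 1) by (split; nra).
      rewrite Rabs_pos_eq by (apply Rmult_le_pos; lra). nra. }
    set (V := Series (fun j => be (S j) ^ 2 * (Z (2 * j + 2)%nat / (1 + be 0%nat)))).
    replace (Series_from 1 (fun n => be n ^ 2 * _)) with (V + L).
    2:{ symmetry. apply is_series_unique.
        eapply is_series_ext; [|exact (is_series_plus _ _ _ _ (Series_correct _ Hv) Hw1)].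
        intros j. change (be (S j) ^ 2 * (Z (2 * j + 2)%nat / (1 + be 0%nat)) +
          q (S j) * Series_from (S j) z = be (1 + j)%nat ^ 2 *
          (Z (2 * (1 + j))%nat / (1 + be 0%nat) + Series_from (2 * (1 + j) + 1) Z)).
        rewrite Htail. replace (2 * (1 + j))%nat with (2 * j + 2)%nat by lia.
        change (q (S j)) with (be (S j) ^ 2). change (1 + j)%nat with (S j). ring. }
    eapply is_series_ext; [|exact (is_series_plus _ _ _ _ (is_series_linear_part s Hs)
      (is_series_scal_l sigma _ _ (is_series_plus _ _ _ _ (Series_correct _ Hv) (Series_correct _ He))))].
    intros k. cbv beta. rewrite !Hs1 by lia.
    transitivity (sigma * be (2 * k + 1)%nat * Z (2 * k + 1)%nat +
      sigma * be (2 * k + 2)%nat * Z (2 * k + 2)%nat +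
      sigma * (be (S k) ^ 2 * (Z (2 * k + 2)%nat / (1 + be 0%nat)) + z k * sum_n q k));
      [reflexivity|].
    match goal with |- ?x = ?y => change (@eq R x y) end.
    rewrite Hq. unfold z, Rdiv. ring.
Qed.

End Refined.

(** * The refined Bohr sums *)

(** The point r lies in its own neighbourhood, where uniform closeness to the real part of [Lim_seq]
    is convergence to it. *)
Lemma class_F_summable (zeta : nat -> R -> R) r :
  class_F zeta -> 0 <= r < 1 -> ex_series (fun n => zeta n r).
Proof.
  intros [_ [_ H]] Hr. destruct (H r Hr) as [d Hd].
  exists (real (Lim_seq (fun N => sum_n (fun n => zeta n r) N))).
  refine (proj1 (is_lim_seq_spec _ (Finite _)) _). intros eps.
  destruct (Hd eps) as [N HN]. exists N. intros n Hn.
  apply (HN n Hn r). split; [assumption|].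
  rewrite Rminus_diag, Rabs_R0. apply cond_pos.
Qed.

Lemma class_B_disc_bounded p m f a : class_B f -> lacunary_expansion p m f a ->
  disc_bounded p m (fun n => a (n * p + m)%nat).
Proof.
  intros [_ Hf] Ha z Hz. destruct (Ha z Hz) as [s [Hs E]].
  exists s. split; [exact Hs|]. rewrite <- Cmod_pow, <- Cmod_mult, <- E.
  apply Rlt_le, Hf, Hz.
Qed.

Lemma sum_sqr_le_1 p m b n : (1 <= p)%nat -> disc_bounded p m b ->
  sum_n (fun i => Cmod (b i) ^ 2) n <= 1.
Proof.
  intros Hp H. pose proof (coef_bound_odd p m b n Hp H).
  pose proof (Cmod_ge_0 (b (2 * n + 1)%nat)). lra.
Qed.

Lemma coef_le_1 p m b n : (1 <= p)%nat -> disc_bounded p m b -> 0 <= Cmod (b n) <= 1.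
Proof.
  intros Hp H. pose proof (Cmod_ge_0 (b n)) as H0. split; [assumption|].
  assert (Cmod (b n) ^ 2 <= 1); [|nra].
  eapply Rle_trans; [|apply (sum_sqr_le_1 p m b n Hp H)].
  destruct n as [|n]; [rewrite sum_O; lra|]. rewrite sum_Sn.
  assert (0 <= sum_n (fun i => Cmod (b i) ^ 2) n).
  { apply sum_n_nonneg. intros; apply pow2_ge_0. }
  change (Cmod (b (S n)) ^ 2 <= sum_n (fun i => Cmod (b i) ^ 2) n + Cmod (b (S n)) ^ 2).
  lra.
Qed.

Lemma pow_m1_even n : Nat.Even n -> (-1) ^ n = 1.
Proof. intros [k ->]. apply pow_1_even. Qed.

Lemma pow_m1_odd n : Nat.Odd n -> (-1) ^ n = -1.
Proof. intros [k ->]. rewrite Nat.add_1_r. apply pow_1_odd. Qed.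

Lemma monomial_seq_incr c tau n r r' : (forall n, 0 <= c n) -> 0 <= r <= r' ->
  monomial_seq c tau n r <= monomial_seq c tau n r'.
Proof.
  intros Hc Hr. unfold monomial_seq. apply Rmult_le_compat_l; [apply Hc|].
  now apply pow_incr.
Qed.

(* Coquelicot puts two normed module structures on [C], with the same operations
   and norm but different uniform structures; its product rule uses the other one. *)
Lemma is_derive_C (f : C -> C) (z l : C) :
  is_derive (K := C_AbsRing) (V := AbsRing_NormedModule C_AbsRing) f z l ->
  is_derive (K := C_AbsRing) (V := C_NormedModule) f z l.
Proof.
  intros [[Hp Hs Hn] H]. split; [constructor; assumption|].
  intros x Hx. exact (H x Hx).
Qed.

Lemma ex_derive_Cpow n (z : C) :
  ex_derive (K := C_AbsRing) (V := C_NormedModule) (fun w : C => (w ^ n)%C) z.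
Proof.
  enough (H : ex_derive (K := C_AbsRing) (V := AbsRing_NormedModule C_AbsRing)
    (fun w : C => (w ^ n)%C) z).
  { destruct H as [l H]. exists l. now apply is_derive_C. }
  induction n as [|n [l IH]].
  - eexists. exact (is_derive_const (K := C_AbsRing) (V := AbsRing_NormedModule C_AbsRing) (RtoC 1) z).
  - eexists. exact (is_derive_mult (K := C_AbsRing) (fun w => w) (fun w : C => (w ^ n)%C) z _ _
      (is_derive_id z) IH Cmult_comm).
Qed.

(** * The extremal function z^(p+m) *)

Lemma class_B_Cpow n : (1 <= n)%nat -> class_B (fun z => (z ^ n)%C).
Proof.
  intros Hn. split; intros z Hz; [apply ex_derive_Cpow|].
  rewrite Cmod_pow. apply pow_lt_1_base; [|assumption].
  split; [apply Cmod_ge_0|exact Hz].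
Qed.

(** The Taylor coefficients of z^j. For j = p + m, the index np + m meets j exactly at n = 1. *)
Definition indicator (j i : nat) : C := if Nat.eq_dec i j then 1 else 0.

Lemma indicator_arith p m n : (1 <= p)%nat ->
  indicator (p + m) (n * p + m) = RtoC (if Nat.eq_dec n 1 then 1 else 0).
Proof.
  intros Hp. unfold indicator. destruct (Nat.eq_dec n 1) as [->|Hn].
  - destruct (Nat.eq_dec (1 * p + m) (p + m)); [reflexivity|lia].
  - destruct (Nat.eq_dec (n * p + m) (p + m)); [nia|reflexivity].
Qed.

Lemma lacunary_expansion_Cpow p m : (1 <= p)%nat ->
  lacunary_expansion p m (fun z => (z ^ (p + m))%C) (indicator (p + m)).
Proof.
  intros Hp z _. exists (z ^ p)%C. split; [|now rewrite Nat.add_comm, Cpow_add_r].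
  set (u := fun n => (indicator (p + m) (n * p + m) * z ^ (n * p))%C).
  (* The partial sums are constant from index 1 on. *)
  assert (E : forall N, (1 <= N)%nat -> Csum u N = (z ^ p)%C).
  { intros N HN. rewrite (Csum_single _ _ 1); [|assumption|].
    - unfold u. rewrite indicator_arith by assumption. simpl. rewrite Nat.add_0_r. ring.
    - intros i _ Hi. unfold u. rewrite indicator_arith by assumption.
      destruct (Nat.eq_dec i 1); [contradiction|ring]. }
  eapply filterlim_ext_loc; [|apply filterlim_const].
  exists 1%nat. intros N HN. symmetry. now apply E.
Qed.

Lemma sum_n_indicator k :
  sum_n (fun i => (if Nat.eq_dec i 1 then 1 else 0) ^ 2) k =
  if Nat.eq_dec k 0 then 0 else 1.
Proof.
  induction k as [|k IH]; [rewrite sum_O; simpl; ring|].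
  rewrite sum_Sn, IH. change (@plus R_AbelianMonoid) with Rplus.
  destruct k; simpl; ring.
Qed.

(** * The two bounds and the values at the extremal function *)

Section Bohr.
Variables (p m : nat) (c : nat -> R) (tau : nat -> nat).
Hypotheses (hp : (1 <= p)%nat) (hc : forall n, 0 <= c n)
  (hF : class_F (monomial_seq c tau))
  (hdecr : forall (n : nat) (r : R), 0 <= r < 1 ->
     monomial_seq c tau (S n) r <= monomial_seq c tau n r).

Let zeta := monomial_seq c tau.
Let d := monomial_deg tau p m.

Lemma zeta_nonneg n r : 0 <= r < 1 -> 0 <= zeta n r.
Proof. apply hF. Qed.

Lemma zeta_pow_summable r : 0 <= r < 1 -> ex_series (fun n => zeta n (r ^ p)).
Proof. intros Hr. now apply class_F_summable, pow_lt_1_base. Qed.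

Lemma zeta_odd_summable r : 0 <= r < 1 -> ex_series (fun k => zeta (2 * k + 1)%nat (r ^ p)).
Proof.
  intros Hr. apply (ex_series_reindex (fun n => zeta n (r ^ p))).
  - intros n. now apply zeta_nonneg, pow_lt_1_base.
  - now apply zeta_pow_summable.
  - now left.
Qed.

Lemma zeta_pairs r : 0 <= r < 1 ->
  is_series (fun k => zeta (2 * k + 1)%nat (r ^ p) + zeta (2 * k + 2)%nat (r ^ p))
    (Series_from 1 (fun n => zeta n (r ^ p))).
Proof.
  intros Hr.
  eapply is_series_ext; [|exact (is_series_pairs _ _
    (Series_correct _ (ex_series_from _ 1 (zeta_pow_summable r Hr))))].
  intros k. cbv beta. f_equal; f_equal; lia.
Qed.

(** Both the prefactor and the dominating series increase with the radius, and their product at r0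
    is 1. *)
Lemma weighted_le_1 (z : nat -> R -> R) r r0 X :
  0 <= r <= r0 -> r0 < 1 ->
  (forall k, 0 <= z k (r ^ p) <= z k (r0 ^ p)) ->
  ex_series (fun k => z k (r0 ^ p)) ->
  zeta m r0 * Series (fun k => z k (r0 ^ p)) = 1 ->
  Rabs X <= Series (fun k => z k (r ^ p)) -> Rabs (zeta m r * X) <= 1.
Proof.
  intros Hr Hr0 Hz He E HX. rewrite <- E, Rabs_mult.
  pose proof (zeta_nonneg m r ltac:(lra)).
  rewrite (Rabs_pos_eq (zeta m r)) by assumption.
  apply Rmult_le_compat; [assumption|apply Rabs_pos|now apply monomial_seq_incr|].
  eapply Rle_trans; [exact HX|]. now apply Series_le.
Qed.

(** Naming the bracket X as the sum of an explicit series serves twice: its terms are estimated for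
    the bound and computed for the extremal function. *)
Lemma C_star_series a sigma r :
  disc_bounded p m (fun n => a (n * p + m)%nat) -> 0 <= r < 1 -> Rabs sigma = 1 ->
  (forall k, (-1) ^ d (2 * k + 1)%nat = sigma) ->
  (forall k, (-1) ^ d (2 * k + 2)%nat = - sigma) ->
  exists X, C_star c tau p m a sigma r = zeta m r * X /\
  is_series (fun k => sigma *
    (zeta (2 * k + 1)%nat (r ^ p) * (Cmod (a ((2 * k + 1) * p + m)%nat) +
       sum_n (fun i => Cmod (a (i * p + m)%nat) ^ 2) k) -
     Cmod (a ((2 * k + 2) * p + m)%nat) * zeta (2 * k + 2)%nat (r ^ p))) X.
Proof.
  intros Ha Hr Hs Hodd Heven. eexists. split; [unfold C_star; reflexivity|].
  apply (is_series_alternating (fun n => zeta n (r ^ p)) (fun n => Cmod (a (n * p + m)%nat)))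
    with (s := fun n => (-1) ^ d n); try assumption.
  - intros n. now apply zeta_nonneg, pow_lt_1_base.
  - now apply zeta_pow_summable.
  - intros n. exact (coef_le_1 p m _ n hp Ha).
  - intros n. exact (sum_sqr_le_1 p m _ n hp Ha).
Qed.

Lemma D_star_series a sigma r :
  disc_bounded p m (fun n => a (n * p + m)%nat) -> 0 <= r < 1 -> Rabs sigma = 1 ->
  (forall n, (1 <= n)%nat -> (-1) ^ d n = sigma) ->
  exists X, D_star c tau p m a sigma r = zeta m r * X /\
  is_series (fun k => sigma *
    (zeta (2 * k + 1)%nat (r ^ p) * (Cmod (a ((2 * k + 1) * p + m)%nat) +
       (sum_n (fun i => Cmod (a (i * p + m)%nat) ^ 2) k - Cmod (a m) ^ 2)) +
     zeta (2 * k + 2)%nat (r ^ p) * (Cmod (a ((2 * k + 2) * p + m)%nat) +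
       (sum_n (fun i => Cmod (a (i * p + m)%nat) ^ 2) k - Cmod (a m) ^ 2) +
       Cmod (a (S k * p + m)%nat) ^ 2 / (1 + Cmod (a m))))) X.
Proof.
  intros Ha Hr Hs Hd. eexists. split; [unfold D_star; reflexivity|].
  apply (is_series_constant_sign (fun n => zeta n (r ^ p)) (fun n => Cmod (a (n * p + m)%nat)))
    with (s := fun n => (-1) ^ d n); try assumption.
  - intros n. now apply zeta_nonneg, pow_lt_1_base.
  - now apply zeta_pow_summable.
  - intros n. exact (coef_le_1 p m _ n hp Ha).
  - intros n. exact (sum_sqr_le_1 p m _ n hp Ha).
Qed.

Lemma C_star_bound a sigma r r0 :
  disc_bounded p m (fun n => a (n * p + m)%nat) -> 0 <= r <= r0 -> r0 < 1 ->
  Rabs sigma = 1 ->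
  (forall k, (-1) ^ d (2 * k + 1)%nat = sigma) ->
  (forall k, (-1) ^ d (2 * k + 2)%nat = - sigma) ->
  zeta m r0 * Series (fun k => zeta (2 * k + 1)%nat (r0 ^ p)) = 1 ->
  Rabs (C_star c tau p m a sigma r) <= 1.
Proof.
  intros Ha Hr Hr0 Hs Hodd Heven E.
  destruct (C_star_series a sigma r Ha ltac:(lra) Hs Hodd Heven) as [X [-> HX]].
  apply (weighted_le_1 (fun k => zeta (2 * k + 1)%nat) r r0); try assumption.
  - intros k. split; [apply zeta_nonneg, pow_lt_1_base; lra || assumption|].
    apply monomial_seq_incr; [assumption|]. split; [apply pow_le; lra|now apply pow_incr].
  - apply zeta_odd_summable. lra.
  - apply (is_series_Rabs_le _ _ _ HX); [|apply zeta_odd_summable; lra].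
    intros k. rewrite Rabs_mult, Hs, Rmult_1_l.
    assert (Hrp : 0 <= r ^ p < 1) by (apply pow_lt_1_base; lra || assumption).
    pose proof (zeta_nonneg (2 * k + 2) _ Hrp) as H2.
    pose proof (hdecr (2 * k + 1) _ Hrp) as H12.
    replace (S (2 * k + 1)) with (2 * k + 2)%nat in H12 by lia.
    fold zeta in H12.
    pose proof (coef_bound_odd p m _ k hp Ha) as B1.
    pose proof (coef_le_1 p m _ (2 * k + 1) hp Ha) as B2.
    pose proof (coef_le_1 p m _ (2 * k + 2) hp Ha) as B3.
    cbv beta in B1, B2, B3.
    assert (B4 : 0 <= sum_n (fun i => Cmod (a (i * p + m)%nat) ^ 2) k).
    { apply sum_n_nonneg. intros; apply pow2_ge_0. }
    (* Above, the odd coefficient inequality gives Z_(2k+1). Below, |b_(2k+2)| <= 1 and the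
       monotonicity of the sequence give -Z_(2k+2) >= -Z_(2k+1). *)
    apply Rabs_le. split; nra.
Qed.

Lemma D_star_bound a sigma r r0 :
  disc_bounded p m (fun n => a (n * p + m)%nat) -> 0 <= r <= r0 -> r0 < 1 ->
  Rabs sigma = 1 ->
  (forall n, (1 <= n)%nat -> (-1) ^ d n = sigma) ->
  zeta m r0 * Series_from 1 (fun n => zeta n (r0 ^ p)) = 1 ->
  Rabs (D_star c tau p m a sigma r) <= 1.
Proof.
  intros Ha Hr Hr0 Hs Hd E.
  destruct (D_star_series a sigma r Ha ltac:(lra) Hs Hd) as [X [-> HX]].
  assert (Hrp : 0 <= r ^ p < 1) by (apply pow_lt_1_base; lra || assumption).
  apply (weighted_le_1 (fun k x => zeta (2 * k + 1)%nat x + zeta (2 * k + 2)%nat x) r r0);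
    try assumption.
  - intros k.
    assert (Hi : forall n, 0 <= zeta n (r ^ p) <= zeta n (r0 ^ p)).
    { intros n. split; [now apply zeta_nonneg|].
      apply monomial_seq_incr; [assumption|]. split; [lra|now apply pow_incr]. }
    pose proof (Hi (2 * k + 1)%nat). pose proof (Hi (2 * k + 2)%nat). lra.
  - eexists. apply zeta_pairs. lra.
  - now rewrite (is_series_unique _ _ (zeta_pairs r0 ltac:(lra))).
  - apply (is_series_Rabs_le _ _ _ HX); [|eexists; apply zeta_pairs; lra].
    intros k. rewrite Rabs_mult, Hs, Rmult_1_l.
    pose proof (zeta_nonneg (2 * k + 1) _ Hrp) as Z1.
    pose proof (zeta_nonneg (2 * k + 2) _ Hrp) as Z2.
    pose proof (coef_bound_odd p m _ k hp Ha) as B1.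
    pose proof (coef_bound_even p m _ k hp Ha) as B2.
    pose proof (Cmod_ge_0 (a ((2 * k + 1) * p + m)%nat)) as B3.
    pose proof (Cmod_ge_0 (a ((2 * k + 2) * p + m)%nat)) as B4.
    pose proof (pow2_ge_0 (Cmod (a m))) as B5.
    cbv beta in B1, B2. change (0 * p + m)%nat with m in B2.
    (* The subtracted |b_0|^2 is part of the sum, so both weights are nonnegative; the odd and even
       coefficient inequalities bound them by 1. *)
    assert (B6 : Cmod (a m) ^ 2 <= sum_n (fun i => Cmod (a (i * p + m)%nat) ^ 2) k).
    { clear. induction k as [|k IH]; [rewrite sum_O; right; reflexivity|].
      rewrite sum_Sn. change (@plus R_AbelianMonoid) with Rplus.
      pose proof (pow2_ge_0 (Cmod (a (S k * p + m)%nat))). lra. }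
    assert (B7 : 0 <= Cmod (a (S k * p + m)%nat) ^ 2 / (1 + Cmod (a m))).
    { apply Rdiv_le_0_compat; [apply pow2_ge_0|]. pose proof (Cmod_ge_0 (a m)). lra. }
    set (x := Cmod (a (S k * p + m)%nat) ^ 2 / (1 + Cmod (a m))) in *.
    apply Rabs_le. split; nra.
Qed.

Lemma indicator_Cmod n :
  Cmod (indicator (p + m) (n * p + m)) = if Nat.eq_dec n 1 then 1 else 0.
Proof.
  rewrite indicator_arith, Cmod_R by assumption.
  destruct (Nat.eq_dec n 1); apply Rabs_pos_eq; lra.
Qed.

Lemma indicator_disc_bounded :
  disc_bounded p m (fun n => indicator (p + m) (n * p + m)).
Proof.
  apply (class_B_disc_bounded p m (fun z => (z ^ (p + m))%C)).
  - apply class_B_Cpow. lia.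
  - now apply lacunary_expansion_Cpow.
Qed.

(** Only b_1 = 1 is nonzero. The weight of Z_(2k+1) is 1 for every k: from |b_1| if k = 0, from the
    sum of squares if k >= 1. *)
Lemma C_star_indicator sigma r : 0 <= r < 1 -> Rabs sigma = 1 ->
  (forall k, (-1) ^ d (2 * k + 1)%nat = sigma) ->
  (forall k, (-1) ^ d (2 * k + 2)%nat = - sigma) ->
  C_star c tau p m (indicator (p + m)) sigma r =
  sigma * (zeta m r * Series (fun k => zeta (2 * k + 1)%nat (r ^ p))).
Proof.
  intros Hr Hs Hodd Heven.
  destruct (C_star_series _ sigma r indicator_disc_bounded Hr Hs Hodd Heven) as [X [-> HX]].
  rewrite <- (is_series_unique _ _ HX), Series_scal_l.
  rewrite <- !Rmult_assoc, (Rmult_comm sigma). f_equal.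
  apply Series_ext. intros k. rewrite !indicator_Cmod.
  rewrite (sum_n_ext _ (fun i => (if Nat.eq_dec i 1 then 1 else 0) ^ 2))
    by (intros; now rewrite indicator_Cmod).
  rewrite sum_n_indicator.
  destruct (Nat.eq_dec (2 * k + 1) 1), (Nat.eq_dec k 0), (Nat.eq_dec (2 * k + 2) 1);
    lia || ring.
Qed.

(** All weights are 1 again. At k = 0, Z_1 gets |b_1| and Z_2 gets |b_1|^2 / (1 + |b_0|) = 1; for k
    >= 1 both weights come from the sum of squares. *)
Lemma D_star_indicator sigma r : 0 <= r < 1 -> Rabs sigma = 1 ->
  (forall n, (1 <= n)%nat -> (-1) ^ d n = sigma) ->
  D_star c tau p m (indicator (p + m)) sigma r =
  sigma * (zeta m r * Series_from 1 (fun n => zeta n (r ^ p))).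
Proof.
  intros Hr Hs Hd.
  destruct (D_star_series _ sigma r indicator_disc_bounded Hr Hs Hd) as [X [-> HX]].
  rewrite <- (is_series_unique _ _ HX), Series_scal_l.
  rewrite <- !Rmult_assoc, (Rmult_comm sigma). f_equal.
  rewrite <- (is_series_unique _ _ (zeta_pairs r Hr)).
  apply Series_ext. intros k.
  change (indicator (p + m) m) with (indicator (p + m) (0 * p + m)).
  rewrite !indicator_Cmod.
  rewrite (sum_n_ext _ (fun i => (if Nat.eq_dec i 1 then 1 else 0) ^ 2))
    by (intros; now rewrite indicator_Cmod).
  rewrite sum_n_indicator.
  destruct (Nat.eq_dec 0 1); [lia|].
  destruct (Nat.eq_dec (2 * k + 1) 1), (Nat.eq_dec k 0), (Nat.eq_dec (2 * k + 2) 1),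
    (Nat.eq_dec (S k) 1); lia || field.
Qed.

End Bohr.

Theorem theorem5
  (p m : nat) (hp : (1 <= p)%nat) (hm : (m <= p)%nat)
  (c : nat -> R) (tau : nat -> nat)
  (hc : forall n : nat, 0 <= c n)
  (hc0 : c 0%nat = 1) (htau0 : tau 0%nat = 0%nat)
  (htau_pos : forall n : nat, (1 <= n)%nat -> (1 <= tau n)%nat)
  (htau_incr : forall i j : nat, (1 <= i)%nat -> (i < j)%nat -> (tau i < tau j)%nat)
  (hF : class_F (monomial_seq c tau))
  (hdecr : forall (n : nat) (r : R), 0 <= r < 1 ->
     monomial_seq c tau (S n) r <= monomial_seq c tau n r) :
  let zeta := monomial_seq c tau in
  let d := monomial_deg tau p m in
  (* (I) *)
  (forall sigma r_star : R,
     ((forall n : nat, (1 <= n)%nat -> Nat.Even (d (2 * n)%nat) /\ Nat.Odd (d (2 * n - 1)%nat)) \/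
      (forall n : nat, (1 <= n)%nat -> Nat.Odd (d (2 * n)%nat) /\ Nat.Even (d (2 * n - 1)%nat))) ->
     (forall n : nat, (1 <= n)%nat -> (-1) ^ d (2 * n - 1)%nat = sigma) ->
     0 < r_star < 1 ->
     zeta m r_star * Series_from 1 (fun n => zeta (2 * n - 1)%nat (r_star ^ p)) = 1 ->
     (forall (f : C -> C) (a : nat -> C), class_B f -> lacunary_expansion p m f a ->
        forall r : R, 0 <= r <= r_star -> Rabs (C_star c tau p m a sigma r) <= 1) /\
     (let f0 := fun z : C => (z ^ (p + m))%C in
      class_B f0 /\
      exists a : nat -> C, lacunary_expansion p m f0 a /\
        Rabs (C_star c tau p m a sigma r_star) = 1)) /\
  (* (II) *)
  (forall sigma R_star : R,
     ((forall n : nat, (1 <= n)%nat -> Nat.Even (d (2 * n)%nat) /\ Nat.Even (d (2 * n - 1)%nat)) \/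
      (forall n : nat, (1 <= n)%nat -> Nat.Odd (d (2 * n)%nat) /\ Nat.Odd (d (2 * n - 1)%nat))) ->
     (forall n : nat, (1 <= n)%nat -> (-1) ^ d n = sigma) ->
     0 < R_star < 1 ->
     zeta m R_star * Series_from 1 (fun n => zeta n (R_star ^ p)) = 1 ->
     (forall (f : C -> C) (a : nat -> C), class_B f -> lacunary_expansion p m f a ->
        forall r : R, 0 <= r <= R_star -> Rabs (D_star c tau p m a sigma r) <= 1) /\
     (let f0 := fun z : C => (z ^ (p + m))%C in
      class_B f0 /\
      exists a : nat -> C, lacunary_expansion p m f0 a /\
        Rabs (D_star c tau p m a sigma R_star) = 1)).
Proof.
  intros zeta d. split.
  - intros sigma r_star Hpar Hsig Hr E.
    assert (Hodd : forall k, (-1) ^ d (2 * k + 1)%nat = sigma).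
    { intros k. rewrite <- (Hsig (S k)) by lia. do 2 f_equal. lia. }
    (* Within each pair the two degrees have opposite parity, hence opposite signs. *)
    assert (Heven : forall k, (-1) ^ d (2 * k + 2)%nat = - sigma).
    { intros k. rewrite <- (Hsig (S k)) by lia.
      replace (2 * k + 2)%nat with (2 * S k)%nat by lia.
      destruct Hpar as [H|H]; destruct (H (S k) ltac:(lia)) as [H1 H2].
      - rewrite (pow_m1_even _ H1), (pow_m1_odd _ H2). ring.
      - rewrite (pow_m1_odd _ H1), (pow_m1_even _ H2). ring. }
    assert (Hs : Rabs sigma = 1) by (rewrite <- (Hodd 0%nat); apply pow_1_abs).
    (* The substitution n = k + 1 turns the indices 2n - 1 of the root equation into 2k + 1. *)
    assert (E' : zeta m r_star * Series (fun k => zeta (2 * k + 1)%nat (r_star ^ p)) = 1).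
    { rewrite <- E. f_equal. apply Series_ext. intros k. f_equal. lia. }
    split; [|split].
    + intros f a Hf Ha r Hrr.
      apply (C_star_bound p m c tau hp hc hF hdecr a sigma r r_star); try assumption; [|lra].
      now apply (class_B_disc_bounded p m f).
    + apply class_B_Cpow. lia.
    + exists (indicator (p + m)). split; [now apply lacunary_expansion_Cpow|].
      (* At the root the value is sigma times 1, of modulus 1. *)
      rewrite C_star_indicator by (assumption || lra).
      fold zeta. rewrite E', Rmult_1_r. exact Hs.
  - intros sigma R_star _ Hsig Hr E.
    assert (Hs : Rabs sigma = 1) by (rewrite <- (Hsig 1%nat) by lia; apply pow_1_abs).
    split; [|split].
    + intros f a Hf Ha r Hrr.
      apply (D_star_bound p m c tau hp hc hF a sigma r R_star); try assumption; [|lra].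
      now apply (class_B_disc_bounded p m f).
    + apply class_B_Cpow. lia.
    + exists (indicator (p + m)). split; [now apply lacunary_expansion_Cpow|].
      rewrite D_star_indicator by (assumption || lra).
      fold zeta. rewrite E, Rmult_1_r. exact Hs.
Qed.
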